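(* Let $X$ be an infinite-dimensional complex Banach space and let $T$ be a generalized Drazin invertible bounded linear operator on $X$ with generalized Drazin inverse $T^D$. Then $T$ has the SVEP if and only if $T^D$ has the SVEP.
   Context: A bounded operator $T$ on $X$ is generalized Drazin invertible if there is a bounded operator $S$ on $X$ with $ST=TS$, $STS=S$ and $TST=T+U$ with $U$ quasinilpotent (equivalently, $0$ is not an accumulation point of $\sigma(T)$). Such $S$ is unique; it is called the generalized Drazin inverse of $T$ and denoted $T^D$. $T$ has the single-valued extension property (SVEP) at $\lambda_0\in\mathbb{C}$ if for every open neighborhood $\mathcal{U}$ of $\lambda_0$ the only analytic function $f:\mathcal{U}\to X$ satisfying $(\lambda I-T)f(\lambda)=0$ on $\mathcal{U}$ is $f\equiv0$; $T$ has the SVEP if it has the SVEP at every $\lambda_0\in\mathbb{C}$. *)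

(* Defs.v *)
From HB Require Import structures.
From mathcomp Require Import all_boot all_order all_algebra.
From mathcomp Require Import complex.
From mathcomp Require Import all_classical all_reals topology normedtype derive.

Set Implicit Arguments.
Unset Strict Implicit.
Unset Printing Implicit Defensive.

Import Order.TTheory GRing.Theory Num.Theory.
Import numFieldNormedType.Exports.

Local Open Scope classical_set_scope.
Local Open Scope ring_scope.
Local Open Scope complex_scope.

Definition infinite_dimensional (R : realType) (X : lmodType R[i]) : Prop :=
  ~ exists (n : nat) (e : 'I_n -> X),
      forall x : X, exists c : 'I_n -> R[i], x = \sum_(i < n) c i *: e i.

Section Operators.
Variables (R : realType) (X : normedModType R[i]).
Implicit Types S T U : {linear X -> X}.

(* The norm takes values in the nonnegative reals inside R[i], and [<=] on R[i]
   forces the difference to be real; hence the cast [M%:C] of a real constant. *)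
Definition bounded_operator T : Prop :=
  exists M : R, forall x : X, `|T x| <= M%:C * `|x|.

(* The resolvent operator is required to be bounded: invertibility is meant in
   the algebra of bounded operators. *)
Definition resolvent_set T : set R[i] :=
  [set lambda | exists S, [/\ bounded_operator S,
     forall x, S (lambda *: x - T x) = x &
     forall x, lambda *: S x - T (S x) = x]].

Definition spectrum T : set R[i] := ~` resolvent_set T.

Definition quasinilpotent T : Prop := spectrum T = [set 0].

(* [S] is the generalized Drazin inverse of [T]; it is unique when it exists, so
   it is given as a relation. *)
Definition generalized_Drazin_inverse T S : Prop :=
  [/\ bounded_operator S,
      forall x, S (T x) = T (S x),
      forall x, S (T (S x)) = S x &
      exists U, [/\ bounded_operator U, quasinilpotent U &
                    forall x, T (S (T x)) = T x + U x]].

(* Functions defined on an open set [D] are represented by total functions whose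
   values outside [D] are irrelevant: for open [D], derivability at a point of
   [D] only depends on the values on [D].  The scalars are R[i], so the
   directional derivative along 1 is the complex derivative. *)
Definition analytic_on (D : set R[i]) (f : R[i] -> X) : Prop :=
  forall z, D z -> derivable (f : R[i]^o -> X) z 1.

Definition SVEP_at T (lambda0 : R[i]) : Prop :=
  forall D : set R[i]^o, open D -> D lambda0 ->
  forall f : R[i] -> X, analytic_on D f ->
    (forall z, D z -> z *: f z - T (f z) = 0) ->
    forall z, D z -> f z = 0.

Definition SVEP T : Prop := forall lambda0 : R[i], SVEP_at T lambda0.

End Operators.

(* Main.v *)
Require Import Defs.
From HB Require Import structures.
From mathcomp Require Import all_boot all_order all_algebra.
From mathcomp Require Import complex.
From mathcomp Require Import all_classical all_reals topology normedtype derive.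

Import Order.TTheory GRing.Theory Num.Theory.
Import numFieldNormedType.Exports.

Local Open Scope ring_scope.
Local Open Scope complex_scope.

(** An operator and its generalized Drazin inverse have the same eigenvectors
    for nonzero eigenvalues, with inverse eigenvalues: for [z != 0],
    [T x = z x] holds if and only if [TD x = (1/z) x].  From [TD] to [T] this is
    algebra, because [TD x = z x] puts [x] in the range of the idempotent
    [P = T TD], on which [TD] is invertible with inverse [T]
    ([eigen_of_Drazin_inverse]).  From [T] to [TD] quasinilpotence enters: for a
    [z]-eigenvector [x] of [T], the component [x - P x] satisfies
    [U (x - P x) = - z (x - P x)] with [U = T TD T - T] quasinilpotent, so it
    vanishes and again [x = P x] ([Drazin_inverse_eigen]).

    Consequently, if [f] is an analytic family of eigenvectors of one operator on
    [D], then [w |-> f (1/w)] is an analytic family for the other one on the set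
    of the [w != 0] with [1/w] in [D], and the SVEP of the latter operator kills
    [f] away from [0].  The remaining value [f 0] vanishes by continuity
    ([SVEP_transfer]). *)

Section Analytic.
Variables (R : realType) (X : normedModType R[i]).
Implicit Types (D : set R[i]^o) (f : R[i] -> X).

Lemma derivable_comp_inv f (w : R[i]) : w != 0 ->
  derivable (f : R[i]^o -> X) w^-1 1 ->
  derivable ((fun z => f z^-1) : R[i]^o -> X) w 1.
Proof.
move=> w0 /derivable1_diffP df; apply/derivable1_diffP.
exact: (@differentiable_comp _ _ _ _ (GRing.inv : R[i]^o -> R[i]^o) f w
         (differentiable_Rinv w0) df).
Qed.

Lemma open_inv_preimage D : open D ->
  open [set w : R[i]^o | w != 0 /\ D w^-1]%classic.
Proof.
move=> oD; rewrite openE => w [w0 Dw].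
have near0 : nbhs w (fun z : R[i]^o => z != 0).
  apply: open_nbhs_nbhs; split=> //.
  have -> : (fun z : R[i]^o => is_true (z != 0)) = (~` [set (0 : R[i]^o)])%classic.
    by apply/funext => z; apply/propext; split => /eqP.
  apply/closed_openC/accessible_closed_set1/hausdorff_accessible.
  exact: norm_hausdorff.
have nearD : nbhs w (fun z : R[i]^o => D z^-1).
  apply: (@inv_continuous _ (w : R[i]^o) w0).
  exact: open_nbhs_nbhs.
by apply: filterS2 near0 nearD => z.
Qed.

(** A point is not isolated in the complex plane, so the value of [f] at [a] is
    the limit of its values at the other points of [D]. *)
Lemma analytic_eq0_at D f (a : R[i]) : open D -> D a -> analytic_on D f ->
  (forall z, D z -> z != a -> f z = 0) -> f a = 0.
Proof.
move=> oD Da /(_ a Da) /derivable1_diffP /differentiable_continuous fa f0.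
have fa' : ((f : R[i]^o -> X) z @[z --> (a : R[i]^o)^'] --> f a)%classic.
  exact: cvg_trans (cvg_app _ (@nbhs_dnbhs _ _)) fa.
have f0' : ((f : R[i]^o -> X) z @[z --> (a : R[i]^o)^'] --> (0 : X))%classic.
  apply: (@cvg_near_cst _ _ _ (f : R[i]^o -> X)).
  rewrite near_withinE.
  have : nbhs (a : R[i]^o) D by exact: open_nbhs_nbhs.
  by apply: filterS => z Dz za; apply: f0.
exact: (cvg_unique (@norm_hausdorff _ X) fa' f0').
Qed.

(** The hypothesis says that the substitution [z |-> 1/z] turns solutions of
    [(z - B) f z = 0] into solutions for [A].  It excludes [z = 0], where the
    substitution is undefined; that single point is recovered by continuity. *)
Lemma SVEP_transfer (A B : {linear X -> X}) :
    (forall z x, z != 0 -> B x = z *: x -> A x = z^-1 *: x) ->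
  SVEP A -> SVEP B.
Proof.
move=> AB svepA _ D oD _ f df Bf.
have f0 z : D z -> z != 0 -> f z = 0.
  move=> Dz z0.
  have D'z : ([set w : R[i]^o | w != 0 /\ D w^-1] z^-1)%classic.
    by rewrite /= invr_eq0 invrK.
  rewrite -[z]invrK.
  apply: (svepA _ _ (open_inv_preimage _ oD) D'z (fun w => f w^-1)) => //.
  - by move=> w [w0 Dw]; apply: derivable_comp_inv => //; exact: df.
  - move=> w [w0 Dw]; apply/eqP; rewrite subr_eq0; apply/eqP/esym.
    rewrite -[w in w *: _]invrK; apply: AB; first by rewrite invr_eq0.
    by apply/esym/eqP; rewrite -subr_eq0 Bf.
move=> z Dz; have [z0|] := eqVneq z 0; last exact: f0.
by rewrite z0 in Dz *; apply: (analytic_eq0_at D).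
Qed.

End Analytic.

Section Eigen.
Variables (R : realType) (X : normedModType R[i]).
Implicit Types T S U : {linear X -> X}.

(** A nonzero [z] is in the resolvent set of [U], so [z - U] is injective. *)
Lemma quasinilpotent_eigen0 U z x :
  quasinilpotent U -> z != 0 -> U x = z *: x -> x = 0.
Proof.
move=> qU z0 Ux.
have [V [_ VU _]] : resolvent_set U z.
  apply: contrapT => nz; have : spectrum U z by [].
  by rewrite qU => /eqP; rewrite (negbTE z0).
by rewrite -[x]VU Ux subrr linear0.
Qed.

(** The relation [S T S = S] makes [S T] fix the range of [S], which contains
    [x] since [z != 0]. *)
Lemma eigen_of_Drazin_inverse T S z x : generalized_Drazin_inverse T S ->
  z != 0 -> S x = z *: x -> T x = z^-1 *: x.
Proof.
move=> [_ ST STS _] z0 Sx.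
have STx : S (T x) = x.
  by apply: (scalerI z0); rewrite -!linearZ -Sx STS.
by rewrite -[in RHS]STx ST Sx linearZ scalerK.
Qed.

(** The point is [T S x = x]: the projection [1 - T S] commutes with [T], so it
    sends [x] to a vector on which [T], hence [- U], acts as multiplication by
    [z]. *)
Lemma Drazin_inverse_eigen T S z x : generalized_Drazin_inverse T S ->
  z != 0 -> T x = z *: x -> S x = z^-1 *: x.
Proof.
move=> [_ ST STS [U [_ qU TST]]] z0 Tx.
have Px : T (S x) = x.
  apply/esym/eqP; rewrite -subr_eq0; apply/eqP.
  apply: (@quasinilpotent_eigen0 U (- z)); rewrite ?oppr_eq0 //.
  have UE y : U y = T (S (T y)) - T y by rewrite TST addrAC subrr add0r.
  have UTS : U (T (S x)) = 0 by rewrite UE ST STS subrr.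
  by rewrite linearB UTS subr0 UE Tx !linearZ /= -scalerDr scaleNr -scalerN opprB.
by rewrite -[in RHS]Px -ST Tx linearZ scalerK.
Qed.

End Eigen.

Theorem theorem4p4 (R : realType) (X : completeNormedModType R[i])
    (hX : infinite_dimensional X)
    (T TD : {linear X -> X})
    (hT : bounded_operator T)
    (hTD : generalized_Drazin_inverse T TD) :
  SVEP T <-> SVEP TD.
Proof.
split; apply: SVEP_transfer => z x.
- exact: eigen_of_Drazin_inverse.
- exact: Drazin_inverse_eigen.
Qed.
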